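(* For any complex number $q$ with $|q|<1$, we have $$\sum_{k=0}^{\infty}q^{k^2}[6k+1]\frac{(q;q^2)_k^2\,(q^2;q^4)_k}{(q^4;q^4)_k^3}=\frac{(1+q)(q^2;q^4)_{\infty}(q^6;q^4)_{\infty}}{(q^4;q^4)_{\infty}^2}$$ and $$\sum_{k=0}^{\infty}(-1)^k q^{3k^2}[6k+1]\frac{(q;q^2)_k^3}{(q^4;q^4)_k^3}=\frac{(q^3;q^4)_\infty (q^5;q^4)_\infty}{(q^4;q^4)_\infty^2}.$$
   Context: The $q$-shifted factorial is defined by $(a;q)_n=(1-a)(1-aq)\cdots(1-aq^{n-1})$ for integers $n\geq 1$ and $(a;q)_0=1$. For $|q|<1$, $(a;q)_\infty=\prod_{j=0}^{\infty}(1-aq^j)$. Thus, for example, $(q;q^2)_k=\prod_{j=0}^{k-1}(1-q^{2j+1})$ and $(q^3;q^4)_\infty=\prod_{j=0}^\infty(1-q^{4j+3})$. Powers such as $(a;q)_n^m$ mean $((a;q)_n)^m$. The $q$-integer is $[n]=1+q+\cdots+q^{n-1}$. *)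

(* Defs.v *)
From Stdlib Require Import Reals Lra Lia.
From Coquelicot Require Import Coquelicot.

Open Scope C_scope.

(** [(a; q)_n] *)
Fixpoint qpoch (a q : C) (n : nat) : C :=
  match n with
  | O => 1
  | S m => qpoch a q m * (1 - a * q ^ m)
  end.

Definition is_qpoch_inf (a q l : C) : Prop :=
  filterlim (qpoch a q) eventually (locally l).

(** [(a; q)_oo] as a total function, in the style of Coquelicot's [RInt]:
    it is meaningful when the partial products converge, in particular for
    [|q| < 1] (lemma [qpoch_inf_correct]). *)
Definition qpoch_inf (a q : C) : C :=
  iota (T := C_CompleteNormedModule) (is_qpoch_inf a q).

(** [[n] = 1 + q + ... + q^(n-1)]; a polynomial in [q], so no condition
    [q <> 1] is involved. *)
Fixpoint qint (q : C) (n : nat) : C :=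
  match n with
  | O => 0
  | S m => qint q m + q ^ m
  end.

Lemma is_qpoch_inf_unique (a q l : C) :
  is_qpoch_inf a q l -> qpoch_inf a q = l.
Proof.
  intros H.
  exact (iota_filterlim_locally (V := C_CompleteNormedModule)
           (F := eventually) (qpoch a q) l H).
Qed.

Lemma qpoch_bounded (a q : C) (n : nat) : (Cmod q < 1)%R ->
  (Cmod (qpoch a q n) <= exp (Cmod a / (1 - Cmod q)))%R.
Proof.
  intros Hq.
  pose proof (Cmod_ge_0 a) as Ha. pose proof (Cmod_ge_0 q) as Hq0.
  assert (Hpow : (0 <= Cmod q ^ n)%R) by now apply pow_le.
  enough (H : (Cmod (qpoch a q n)
               <= exp (Cmod a * ((1 - Cmod q ^ n) / (1 - Cmod q))))%R).
  { apply Rle_trans with (1 := H).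
    assert (Hle : (Cmod a * ((1 - Cmod q ^ n) / (1 - Cmod q))
                   <= Cmod a / (1 - Cmod q))%R).
    { unfold Rdiv. apply Rmult_le_compat_l; [exact Ha|].
      rewrite <- (Rmult_1_l (/ (1 - Cmod q))) at 2.
      apply Rmult_le_compat_r; [|lra].
      apply Rlt_le, Rinv_0_lt_compat; lra. }
    destruct (Rle_lt_or_eq_dec _ _ Hle) as [Hlt|Heq].
    - now apply Rlt_le, exp_increasing.
    - rewrite Heq; apply Rle_refl. }
  clear Hpow. induction n as [|n IH].
  - simpl. rewrite Cmod_1. unfold Rdiv.
    replace (Cmod a * ((1 - 1) * / (1 - Cmod q)))%R with 0%R by ring.
    rewrite exp_0; lra.
  - replace (Cmod a * ((1 - Cmod q ^ S n) / (1 - Cmod q)))%R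
      with (Cmod a * ((1 - Cmod q ^ n) / (1 - Cmod q))
            + Cmod a * Cmod q ^ n)%R by (simpl; field; lra).
    rewrite exp_plus. simpl. rewrite Cmod_mult.
    apply Rmult_le_compat; try apply Cmod_ge_0; [exact IH|].
    apply Rle_trans with (Cmod 1 + Cmod (- (a * q ^ n)))%R.
    + apply Cmod_triangle.
    + rewrite Cmod_1, Cmod_opp, Cmod_mult, Cmod_pow.
      apply exp_ineq1_le.
Qed.

Lemma qpoch_inf_correct (a q : C) : (Cmod q < 1)%R ->
  is_qpoch_inf a q (qpoch_inf a q).
Proof.
  intros Hq.
  pose proof (Cmod_ge_0 a) as Ha. pose proof (Cmod_ge_0 q) as Hq0.
  set (d := fun n => qpoch a q n * - (a * q ^ n)).
  assert (Hd : ex_series (V := C_CompleteNormedModule) d).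
  { apply ex_series_le with
      (b := fun n => (exp (Cmod a / (1 - Cmod q)) * Cmod a * Cmod q ^ n)%R).
    - intros n. change (norm (d n)) with (Cmod (d n)). unfold d.
      rewrite Cmod_mult, Cmod_opp, Cmod_mult, Cmod_pow, Rmult_assoc.
      apply Rmult_le_compat_r.
      + apply Rmult_le_pos; [exact Ha | now apply pow_le].
      + now apply qpoch_bounded.
    - apply (ex_series_scal (V := R_NormedModule)).
      apply ex_series_geom. rewrite Rabs_pos_eq; assumption. }
  destruct Hd as [l Hl].
  assert (Hsum : forall n, qpoch a q (S n) = 1 + sum_n d n).
  { induction n as [|n IH].
    - rewrite sum_O. unfold d. simpl. ring.
    - rewrite sum_Sn. change (plus (sum_n d n) (d (S n)))
        with (sum_n d n + d (S n)).
      rewrite Cplus_assoc, <- IH. unfold d.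
      change (qpoch a q (S (S n)))
        with (qpoch a q (S n) * (1 - a * q ^ S n)). ring. }
  assert (Hlim : is_qpoch_inf a q (1 + l)).
  { intros P HP.
    assert (HS : filterlim (fun n => plus (1 : C) (sum_n d n)) eventually
                   (locally (plus (1 : C) l))).
    { apply (filterlim_comp_2 (F := eventually) (G := locally (1 : C))
               (H := locally l)).
      - apply filterlim_const.
      - exact Hl.
      - exact (filterlim_plus (V := C_NormedModule) (RtoC 1) l). }
    destruct (HS P HP) as [N HN].
    exists (S N). intros n Hn. destruct n as [|n]; [lia|].
    rewrite Hsum. apply HN. lia. }
  rewrite (is_qpoch_inf_unique _ _ _ Hlim). exact Hlim.
Qed.

(* Main.v *)
(** With [T x = sum_k c_k * prod_(j < k) (x - q^(4j)) * (q^(2k+3) x; q^2)_oo]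
    and [c_k = q^(k^2+2k) [6k+1] (q; q^2)_k^3 / (q^4; q^4)_k^3], creative
    telescoping gives [T x = (1 - q^4 x)^2 * T (q^4 x)], hence
    [T x = (q^4 x; q^4)_oo^2 * T 0].  At [x = 1] only the term [k = 0] survives,
    which yields [T 0 = (q^3; q^2)_oo / (q^4; q^4)_oo^2].  Since
    [prod_(j < k) (- q^(4j)) = (-1)^k q^(2k(k-1))], the series [T 0] is the
    second sum of the theorem; and [T (q^(-2))] is [(q; q^2)_oo] times the
    first sum. *)

Require Import Defs.
From Stdlib Require Import Reals Lra Lia.
From Coquelicot Require Import Coquelicot.

Open Scope C_scope.

(** * Limits and dominated series of complex numbers *)

Definition is_Clim (u : nat -> C) (l : C) : Prop :=
  filterlim u eventually (locally l).

Lemma is_Clim_spec (u : nat -> C) (l : C) :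
  is_Clim u l <->
  (forall eps : posreal, eventually (fun n => Cmod (u n - l) < eps)%R).
Proof.
  exact (filterlim_locally_ball_norm (U := C_NormedModule)
           (F := eventually) u l).
Qed.

Lemma is_Clim_unique (u : nat -> C) (l l' : C) :
  is_Clim u l -> is_Clim u l' -> l = l'.
Proof.
  exact (filterlim_locally_unique (V := C_NormedModule) (F := eventually) u l l').
Qed.

Lemma is_Clim_const (c : C) : is_Clim (fun _ => c) c.
Proof. exact (filterlim_const c). Qed.

Lemma is_Clim_ext (u v : nat -> C) (l : C) :
  (forall n, u n = v n) -> is_Clim u l -> is_Clim v l.
Proof. exact (filterlim_ext u v). Qed.

Lemma is_Clim_subseq (phi : nat -> nat) (u : nat -> C) (l : C) :
  (forall n, n <= phi n)%nat -> is_Clim u l -> is_Clim (fun n => u (phi n)) l.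
Proof.
  intros Hphi Hu P HP. destruct (Hu P HP) as [N HN].
  exists N. intros n Hn. apply HN. specialize (Hphi n). lia.
Qed.

Lemma is_Clim_plus (u v : nat -> C) (a b : C) :
  is_Clim u a -> is_Clim v b -> is_Clim (fun n => u n + v n) (a + b).
Proof.
  intros Hu Hv.
  exact (filterlim_comp_2 (F := eventually) (G := locally a) (H := locally b)
           u v Cplus Hu Hv (filterlim_plus (V := C_NormedModule) a b)).
Qed.

Lemma is_Clim_mult (u v : nat -> C) (a b : C) :
  is_Clim u a -> is_Clim v b -> is_Clim (fun n => u n * v n) (a * b).
Proof.
  intros Hu Hv.
  (* Continuity of scalar multiplication takes the scalar in the uniform structure of [C_AbsRing],
     while [is_Clim] uses that of the plane; [locally_C] identifies their neighbourhoods. *)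
  apply (filterlim_comp_2 (F := eventually)
           (G := locally (T := AbsRing_UniformSpace C_AbsRing) a)
           (H := locally b) u v Cmult); [|exact Hv|].
  - intros P HP. apply Hu, locally_C, HP.
  - exact (filterlim_scal (V := C_NormedModule) a b).
Qed.

Lemma is_Clim_pow (u : nat -> C) (a : C) (m : nat) :
  is_Clim u a -> is_Clim (fun n => u n ^ m) (a ^ m).
Proof.
  intros Hu. induction m as [|m IH].
  - apply is_Clim_const.
  - exact (is_Clim_mult _ _ _ _ Hu IH).
Qed.

Lemma is_Clim_of_le (u : nat -> C) (l : C) (b : nat -> R) :
  (forall n, Cmod (u n - l) <= b n)%R -> is_lim_seq b 0 -> is_Clim u l.
Proof.
  intros Hle Hb. apply is_Clim_spec. intros eps.
  apply is_lim_seq_spec in Hb.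
  destruct (Hb eps) as [N HN]. exists N. intros n Hn.
  specialize (HN n Hn). specialize (Hle n).
  rewrite Rminus_0_r in HN. apply Rabs_def2 in HN. lra.
Qed.

Lemma Cmod_limit_le (u : nat -> C) (l c : C) (B : R) :
  is_Clim u l -> eventually (fun n => Cmod (u n - c) <= B)%R ->
  (Cmod (l - c) <= B)%R.
Proof.
  intros Hu [N1 H1]. apply le_epsilon. intros e He.
  destruct (proj1 (is_Clim_spec u l) Hu (mkposreal e He)) as [N2 H2].
  simpl in H2.
  specialize (H1 (max N1 N2) ltac:(lia)). specialize (H2 (max N1 N2) ltac:(lia)).
  replace (l - c) with ((u (max N1 N2) - c) + - (u (max N1 N2) - l)) by ring.
  eapply Rle_trans; [apply Cmod_triangle|]. rewrite Cmod_opp. lra.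
Qed.

Lemma Cmod_limit_ge (u : nat -> C) (l : C) (b : R) :
  is_Clim u l -> (forall n, b <= Cmod (u n))%R -> (b <= Cmod l)%R.
Proof.
  intros Hu H1. apply le_epsilon. intros e He.
  destruct (proj1 (is_Clim_spec u l) Hu (mkposreal e He)) as [N H2].
  simpl in H2. specialize (H2 N ltac:(lia)). specialize (H1 N).
  replace (u N) with (l + (u N - l)) in H1 by ring.
  pose proof (Cmod_triangle l (u N - l)). lra.
Qed.

Lemma sum_n_S (a : nat -> C) (n : nat) :
  sum_n (G := C_AbelianMonoid) a (S n) = sum_n (G := C_AbelianMonoid) a n + a (S n).
Proof. exact (sum_Sn (G := C_AbelianMonoid) a n). Qed.

Lemma is_Cseries_unique (a : nat -> C) (l l' : C) :
  is_series (V := C_NormedModule) a l -> is_series (V := C_NormedModule) a l' ->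
  l = l'.
Proof. apply is_Clim_unique. Qed.

(** By the triangle inequality the block from [K] to [n] is at most the same block of [b]. The
    partial sums of [b] increase to [lb], so the bound is uniform in [n] and survives the limit. *)
Lemma series_tail_le (a : nat -> C) (b : nat -> R) (l : C) (lb : R) (K : nat) :
  (forall k, Cmod (a k) <= b k)%R ->
  is_series (V := C_NormedModule) a l -> is_series b lb ->
  (Cmod (l - sum_n (G := C_AbelianMonoid) a K) <= lb - sum_n b K)%R.
Proof.
  intros Hab Ha Hb. apply Cmod_limit_le with (1 := Ha). exists K.
  assert (Hm : forall m,
    (Cmod (sum_n (G := C_AbelianMonoid) a (K + m)
           - sum_n (G := C_AbelianMonoid) a K)
     <= sum_n b (K + m) - sum_n b K)%R).
  { induction m as [|m IH].
    - rewrite Nat.add_0_r. unfold Cminus. rewrite Cplus_opp_r, Cmod_0. lra.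
    - rewrite Nat.add_succ_r, sum_n_S, sum_Sn.
      change (plus (sum_n b (K + m)) (b (S (K + m))))
        with (sum_n b (K + m) + b (S (K + m)))%R.
      match goal with |- context [Cmod (?s + ?x - ?t)] =>
        replace (s + x - t) with ((s - t) + x) by ring end.
      eapply Rle_trans; [apply Cmod_triangle|].
      specialize (Hab (S (K + m))). lra. }
  intros n Hn. replace n with (K + (n - K))%nat by lia.
  eapply Rle_trans; [apply Hm|].
  apply Rplus_le_compat_r.
  apply (is_lim_seq_incr_compare (sum_n b) lb); [exact Hb|].
  intros k. rewrite sum_Sn.
  change (plus (sum_n b k) (b (S k))) with (sum_n b k + b (S k))%R.
  specialize (Hab (S k)). pose proof (Cmod_ge_0 (a (S k))). lra.
Qed.

(** Dominated convergence for series. Past a suitable [K] the tails of [u n] and of [v] are below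
    [eps / 3], uniformly in [n]; the head up to [K] is a finite sum, which converges term by
    term. *)
Lemma tannery (u : nat -> nat -> C) (v : nat -> C) (b : nat -> R)
  (s : nat -> C) (l : C) :
  ex_series b -> (forall n k, Cmod (u n k) <= b k)%R ->
  (forall k, is_Clim (fun n => u n k) (v k)) ->
  (forall n, is_series (V := C_NormedModule) (u n) (s n)) ->
  is_series (V := C_NormedModule) v l ->
  is_Clim s l.
Proof.
  intros [lb Hb] Hub Huv Hs Hl.
  assert (Hvb : forall k, (Cmod (v k) <= b k)%R).
  { intros k. replace (v k) with (v k - 0) by ring.
    apply Cmod_limit_le with (1 := Huv k). exists 0%nat. intros n _.
    replace (u n k - 0) with (u n k) by ring. apply Hub. }
  apply is_Clim_spec. intros eps.
  assert (He : (0 < eps / 3)%R) by (destruct eps; simpl; lra).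
  assert (HK : exists K, (lb - sum_n b K < eps / 3)%R).
  { assert (Hb' : is_lim_seq (sum_n b) lb) by exact Hb.
    apply is_lim_seq_spec in Hb'. destruct (Hb' (mkposreal _ He)) as [K HK].
    exists K. specialize (HK K (le_n K)). simpl in HK.
    apply Rabs_def2 in HK. lra. }
  destruct HK as [K HK].
  assert (Hfin : is_Clim (fun n => sum_n (G := C_AbelianMonoid) (u n) K)
                   (sum_n (G := C_AbelianMonoid) v K)).
  { clear HK. induction K as [|K IH].
    - apply is_Clim_ext with (fun n => u n O);
        [intros n; symmetry; apply (sum_O (G := C_AbelianMonoid))|].
      rewrite (sum_O (G := C_AbelianMonoid)). apply Huv.
    - apply is_Clim_ext
        with (fun n => sum_n (G := C_AbelianMonoid) (u n) K + u n (S K));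
        [intros n; symmetry; apply sum_n_S|].
      rewrite sum_n_S. apply is_Clim_plus; [exact IH | apply Huv]. }
  destruct (proj1 (is_Clim_spec _ _) Hfin (mkposreal _ He)) as [N HN].
  simpl in HN. exists N. intros n Hn. specialize (HN n Hn).
  pose proof (series_tail_le _ _ _ _ K (Hub n) (Hs n) Hb) as T1.
  pose proof (series_tail_le _ _ _ _ K Hvb Hl Hb) as T2.
  set (A := sum_n (G := C_AbelianMonoid) (u n) K) in *.
  set (B := sum_n (G := C_AbelianMonoid) v K) in *.
  replace (s n - l) with ((s n - A) + ((A - B) + - (l - B))) by ring.
  eapply Rle_lt_trans; [apply Cmod_triangle|].
  pose proof (Cmod_triangle (A - B) (- (l - B))) as T3.
  rewrite Cmod_opp in T3. lra.
Qed.

(** * Finite q-shifted factorials: identities and bounds uniform in the length *)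

Lemma qpoch_S (a q : C) (n : nat) :
  qpoch a q (S n) = qpoch a q n * (1 - a * q ^ n).
Proof. reflexivity. Qed.

Lemma qpoch_shift (a q : C) (n : nat) :
  qpoch a q (S n) = (1 - a) * qpoch (a * q) q n.
Proof.
  induction n as [|n IH].
  - simpl. ring.
  - rewrite (qpoch_S a), IH, (qpoch_S (a * q)), Cpow_S. ring.
Qed.

Lemma qpoch_even_odd (a q : C) (n : nat) :
  qpoch a q (2 * n) = qpoch a (q ^ 2) n * qpoch (a * q) (q ^ 2) n.
Proof.
  induction n as [|n IH].
  - simpl. ring.
  - replace (2 * S n)%nat with (S (S (2 * n))) by lia.
    rewrite !qpoch_S, IH, <- Cpow_mult_r, (Cpow_S q (2 * n)). ring.
Qed.

Lemma qint_mult (q : C) (n : nat) : qint q n * (1 - q) = 1 - q ^ n.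
Proof.
  induction n as [|n IH].
  - simpl. ring.
  - change (qint q (S n)) with (qint q n + q ^ n). rewrite Cpow_S.
    replace ((qint q n + q ^ n) * (1 - q))
      with (qint q n * (1 - q) + q ^ n * (1 - q)) by ring.
    rewrite IH. ring.
Qed.

Lemma Cmod_pow_lt_1 (q : C) (n : nat) :
  (Cmod q < 1)%R -> (0 < n)%nat -> (Cmod (q ^ n) < 1)%R.
Proof.
  intros Hq Hn. rewrite Cmod_pow. apply pow_lt_1_compat; [|exact Hn].
  split; [apply Cmod_ge_0 | exact Hq].
Qed.

Lemma one_minus_neq_0 (a : C) : (Cmod a < 1)%R -> 1 - a <> 0.
Proof.
  intros Ha H. replace a with (RtoC 1) in Ha.
  - rewrite Cmod_1 in Ha. lra.
  - replace a with (1 - (1 - a)) by ring. rewrite H. ring.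
Qed.

Lemma geom_partial_le (r : R) (n : nat) :
  (0 <= r < 1)%R -> ((1 - r ^ n) / (1 - r) <= / (1 - r))%R.
Proof.
  intros Hr. unfold Rdiv. rewrite <- (Rmult_1_l (/ (1 - r))) at 2.
  apply Rmult_le_compat_r.
  - apply Rlt_le, Rinv_0_lt_compat; lra.
  - pose proof (pow_le r n (proj1 Hr)). lra.
Qed.

Lemma exp_incr_le (x y : R) : (x <= y)%R -> (exp x <= exp y)%R.
Proof.
  intros [H|H]; [now apply Rlt_le, exp_increasing | rewrite H; lra].
Qed.

(** Consecutive products differ by [qpoch a q n * (a * q ^ n)]; with the first factor bounded
    uniformly, the differences sum to at most a geometric series. The factor [Cmod a] in the bound
    later gives the limit of the infinite product as [a] tends to 0. *)
Lemma qpoch_minus_1_le (a q : C) (n : nat) : (Cmod q < 1)%R ->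
  (Cmod (qpoch a q n - 1)
   <= exp (Cmod a / (1 - Cmod q)) * Cmod a * / (1 - Cmod q))%R.
Proof.
  intros Hq. pose proof (Cmod_ge_0 a) as Ha. pose proof (Cmod_ge_0 q) as Hq0.
  set (E := exp (Cmod a / (1 - Cmod q))).
  assert (HE : (0 < E)%R) by apply exp_pos.
  apply Rle_trans
    with (E * Cmod a * ((1 - Cmod q ^ n) / (1 - Cmod q)))%R.
  2:{ apply Rmult_le_compat_l; [nra | now apply geom_partial_le]. }
  induction n as [|n IH].
  - simpl. unfold Cminus. rewrite Cplus_opp_r, Cmod_0.
    right. field. lra.
  - rewrite qpoch_S.
    replace (qpoch a q n * (1 - a * q ^ n) - 1)
      with ((qpoch a q n - 1) + - (qpoch a q n * (a * q ^ n))) by ring.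
    eapply Rle_trans; [apply Cmod_triangle|].
    rewrite Cmod_opp, !Cmod_mult, Cmod_pow.
    replace (E * Cmod a * ((1 - Cmod q ^ S n) / (1 - Cmod q)))%R
      with (E * Cmod a * ((1 - Cmod q ^ n) / (1 - Cmod q))
            + E * (Cmod a * Cmod q ^ n))%R by (simpl; field; lra).
    apply Rplus_le_compat; [exact IH|].
    apply Rmult_le_compat_r; [|now apply qpoch_bounded].
    apply Rmult_le_pos; [exact Ha | now apply pow_le].
Qed.

(* [1 - y >= exp (- y / (1 - |a|))] for [0 <= y <= |a| < 1], applied to each
   factor. *)
Lemma qpoch_ge (a q : C) (n : nat) : (Cmod a < 1)%R -> (Cmod q < 1)%R ->
  (exp (- (Cmod a / (1 - Cmod a) * / (1 - Cmod q))) <= Cmod (qpoch a q n))%R.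
Proof.
  intros Ha Hq. pose proof (Cmod_ge_0 a) as Ha0. pose proof (Cmod_ge_0 q) as Hq0.
  set (c := (Cmod a / (1 - Cmod a))%R).
  assert (Hc : (0 <= c)%R).
  { apply Rmult_le_pos; [exact Ha0|]. apply Rlt_le, Rinv_0_lt_compat; lra. }
  apply Rle_trans with (exp (- (c * ((1 - Cmod q ^ n) / (1 - Cmod q))))).
  { apply exp_incr_le, Ropp_le_contravar, Rmult_le_compat_l; [exact Hc|].
    now apply geom_partial_le. }
  induction n as [|n IH].
  - simpl. rewrite Cmod_1.
    replace (- (c * ((1 - 1) / (1 - Cmod q))))%R with 0%R by (field; lra).
    rewrite exp_0. lra.
  - replace (- (c * ((1 - Cmod q ^ S n) / (1 - Cmod q))))%R
      with (- (c * ((1 - Cmod q ^ n) / (1 - Cmod q)))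
            + - (c * Cmod q ^ n))%R by (simpl; field; lra).
    rewrite exp_plus, qpoch_S, Cmod_mult.
    apply Rmult_le_compat; try (apply Rlt_le, exp_pos); [exact IH|].
    set (y := (Cmod a * Cmod q ^ n)%R).
    assert (Hp : (0 <= Cmod q ^ n <= 1)%R).
    { split; [now apply pow_le|].
      rewrite <- (pow1 n). apply pow_incr. lra. }
    assert (Hy : (0 <= y <= Cmod a)%R) by (unfold y; nra).
    assert (Hcy : (c * Cmod q ^ n = y / (1 - Cmod a))%R)
      by (unfold c, y; field; lra).
    apply Rle_trans with (1 - y)%R.
    + rewrite exp_Ropp, Hcy.
      pose proof (exp_ineq1_le (y / (1 - Cmod a))) as He.
      apply Rle_trans with (/ (1 + y / (1 - Cmod a)))%R.
      * assert (0 <= y / (1 - Cmod a))%R.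
        { apply Rmult_le_pos; [lra|]. apply Rlt_le, Rinv_0_lt_compat; lra. }
        apply Rinv_le_contravar; lra.
      * replace (1 + y / (1 - Cmod a))%R
          with ((1 - Cmod a + y) / (1 - Cmod a))%R by (field; lra).
        rewrite Rinv_div.
        apply Rmult_le_reg_r with (1 - Cmod a + y)%R; [lra|].
        unfold Rdiv. rewrite Rmult_assoc, Rinv_l by lra. nra.
    + pose proof (Cmod_triangle (1 - a * q ^ n) (a * q ^ n)) as Ht.
      replace (1 - a * q ^ n + a * q ^ n) with (RtoC 1) in Ht by ring.
      rewrite Cmod_1, Cmod_mult, Cmod_pow in Ht. fold y in Ht. lra.
Qed.

Lemma qpoch_neq_0 (a q : C) (n : nat) :
  (Cmod a < 1)%R -> (Cmod q < 1)%R -> qpoch a q n <> 0.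
Proof.
  intros Ha Hq. apply Cmod_gt_0.
  eapply Rlt_le_trans; [apply exp_pos | now apply qpoch_ge].
Qed.

(** * Infinite q-shifted factorials *)

(** The positive lower bound of [qpoch_ge] is independent of [n], so it passes to the limit. *)
Lemma qpoch_inf_neq_0 (a q : C) :
  (Cmod a < 1)%R -> (Cmod q < 1)%R -> qpoch_inf a q <> 0.
Proof.
  intros Ha Hq. apply Cmod_gt_0.
  eapply Rlt_le_trans; [apply exp_pos|].
  apply Cmod_limit_ge with (1 := qpoch_inf_correct a q Hq).
  intros n. now apply qpoch_ge.
Qed.

Lemma qpoch_inf_bounded (a q : C) : (Cmod q < 1)%R ->
  (Cmod (qpoch_inf a q) <= exp (Cmod a / (1 - Cmod q)))%R.
Proof.
  intros Hq. replace (qpoch_inf a q) with (qpoch_inf a q - 0) by ring.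
  apply Cmod_limit_le with (1 := qpoch_inf_correct a q Hq).
  exists 0%nat. intros n _.
  replace (qpoch a q n - 0) with (qpoch a q n) by ring.
  now apply qpoch_bounded.
Qed.

Lemma qpoch_inf_minus_1_le (a q : C) : (Cmod q < 1)%R ->
  (Cmod (qpoch_inf a q - 1)
   <= exp (Cmod a / (1 - Cmod q)) * Cmod a * / (1 - Cmod q))%R.
Proof.
  intros Hq. apply Cmod_limit_le with (1 := qpoch_inf_correct a q Hq).
  exists 0%nat. intros n _. now apply qpoch_minus_1_le.
Qed.

Lemma qpoch_inf_shift (a q : C) : (Cmod q < 1)%R ->
  qpoch_inf a q = (1 - a) * qpoch_inf (a * q) q.
Proof.
  intros Hq. apply is_Clim_unique with (fun n => qpoch a q (S n)).
  - apply is_Clim_subseq with (phi := S); [lia | now apply qpoch_inf_correct].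
  - apply is_Clim_ext with (fun n => (1 - a) * qpoch (a * q) q n).
    + intros n. symmetry. apply qpoch_shift.
    + apply is_Clim_mult; [apply is_Clim_const | now apply qpoch_inf_correct].
Qed.

Lemma qpoch_inf_split (a q : C) (n : nat) : (Cmod q < 1)%R ->
  qpoch_inf a q = qpoch a q n * qpoch_inf (a * q ^ n) q.
Proof.
  intros Hq. induction n as [|n IH].
  - simpl. rewrite Cmult_1_r. ring.
  - rewrite IH, (qpoch_inf_shift (a * q ^ n)) by exact Hq.
    rewrite qpoch_S, Cpow_S.
    replace (a * (q * q ^ n)) with (a * q ^ n * q) by ring. ring.
Qed.

Lemma qpoch_inf_even_odd (a q : C) : (Cmod q < 1)%R ->
  qpoch_inf a q = qpoch_inf a (q ^ 2) * qpoch_inf (a * q) (q ^ 2).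
Proof.
  intros Hq. assert (Hq2 := Cmod_pow_lt_1 q 2 Hq ltac:(lia)).
  apply is_Clim_unique with (fun n => qpoch a q (2 * n)).
  - apply is_Clim_subseq with (phi := fun n => (2 * n)%nat);
      [intros; lia | now apply qpoch_inf_correct].
  - apply is_Clim_ext with (fun n => qpoch a (q ^ 2) n * qpoch (a * q) (q ^ 2) n).
    + intros n. symmetry. apply qpoch_even_odd.
    + apply is_Clim_mult; now apply qpoch_inf_correct.
Qed.

(** * The polynomials in [x] with roots at the powers of [p] *)

(** For nonzero [x] this is [x ^ n] times the factorial [(1/x; p)_n]. The polynomial form also makes
    sense at [x = 0], where the series has to be evaluated. *)
Fixpoint shifted_pow (x p : C) (n : nat) : C :=
  match n with
  | O => 1
  | S m => shifted_pow x p m * (x - p ^ m)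
  end.

Lemma shifted_pow_S (x p : C) (n : nat) :
  shifted_pow x p (S n) = shifted_pow x p n * (x - p ^ n).
Proof. reflexivity. Qed.

(** Every factor after the first is [p * x - p ^ (j + 1) = p * (x - p ^ j)], so the dilation only
    shifts the product by one index. *)
Lemma shifted_pow_dilate (x p : C) (n : nat) :
  shifted_pow (p * x) p (S n) = (p * x - 1) * p ^ n * shifted_pow x p n.
Proof.
  induction n as [|n IH].
  - simpl. ring.
  - rewrite shifted_pow_S, IH, shifted_pow_S, !Cpow_S. ring.
Qed.

Lemma shifted_pow_1 (p : C) (n : nat) : shifted_pow 1 p (S n) = 0.
Proof.
  induction n as [|n IH].
  - simpl. ring.
  - rewrite shifted_pow_S, IH. ring.
Qed.

(** The base is a square so that the exponent, twice the sum of the [j < n], is written without a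
    division by 2. *)
Lemma shifted_pow_0 (p : C) (n : nat) :
  shifted_pow 0 (p ^ 2) n = (- (1)) ^ n * p ^ (n * (n - 1)).
Proof.
  induction n as [|n IH].
  - simpl. ring.
  - rewrite shifted_pow_S, IH, <- Cpow_mult_r, (Cpow_S (- (1)) n).
    replace (S n * (S n - 1))%nat with (n * (n - 1) + 2 * n)%nat by nia.
    rewrite Cpow_add_r. ring.
Qed.

Lemma shifted_pow_inv (y p : C) (n : nat) :
  y <> 0 -> y ^ n * shifted_pow (/ y) p n = qpoch y p n.
Proof.
  intros Hy. induction n as [|n IH].
  - simpl. ring.
  - rewrite shifted_pow_S, qpoch_S, <- IH, Cpow_S. field. exact Hy.
Qed.

Lemma shifted_pow_le (x p : C) (n : nat) : (Cmod p <= 1)%R ->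
  (Cmod (shifted_pow x p n) <= (Cmod x + 1) ^ n)%R.
Proof.
  intros Hp. pose proof (Cmod_ge_0 p) as Hp0. pose proof (Cmod_ge_0 x) as Hx0.
  induction n as [|n IH].
  - simpl. rewrite Cmod_1. lra.
  - rewrite shifted_pow_S, Cmod_mult. simpl pow. rewrite Rmult_comm.
    apply Rmult_le_compat; try apply Cmod_ge_0; [|exact IH].
    eapply Rle_trans; [apply Cmod_triangle|].
    rewrite Cmod_opp, Cmod_pow.
    assert (Cmod p ^ n <= 1)%R.
    { rewrite <- (pow1 n). apply pow_incr. lra. }
    lra.
Qed.

Lemma is_Clim_shifted_pow (y : nat -> C) (l p : C) (k : nat) :
  is_Clim y l ->
  is_Clim (fun n => shifted_pow (y n) p k) (shifted_pow l p k).
Proof.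
  intros Hy. induction k as [|k IH].
  - apply is_Clim_const.
  - apply is_Clim_mult; [exact IH|].
    apply is_Clim_plus; [exact Hy | apply is_Clim_const].
Qed.

(** The left side is [(r ^ k * A) ^ k]. Once [r ^ N * A <= 1 / 2], all [k >= N] are bounded by
    [(1 / 2) ^ k]; for [k < N], [A ^ k = (2 * A) ^ k * (1 / 2) ^ k] costs at most the constant
    [(2 * A) ^ N]. *)
Lemma super_geometric_le (r A : R) : (0 <= r < 1)%R -> (1 <= A)%R ->
  exists K : R, (0 <= K)%R /\
    forall k : nat, (r ^ (k ^ 2) * A ^ k <= K * (1 / 2) ^ k)%R.
Proof.
  intros Hr HA.
  assert (HN : exists N, (r ^ N * A <= 1 / 2)%R).
  { destruct (pow_lt_1_zero r) with (y := (/ (2 * A))%R) as [N HN].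
    - rewrite Rabs_pos_eq; lra.
    - apply Rinv_0_lt_compat; lra.
    - exists N. specialize (HN N (le_n N)). apply Rabs_def2 in HN.
      apply Rle_trans with (/ (2 * A) * A)%R.
      + apply Rmult_le_compat_r; lra.
      + right. field. lra. }
  destruct HN as [N HN].
  assert (HAN : (1 <= (2 * A) ^ N)%R) by (apply pow_R1_Rle; lra).
  exists ((2 * A) ^ N)%R. split; [lra|]. intros k.
  assert (Hh : (0 < (1 / 2) ^ k)%R) by (apply pow_lt; lra).
  assert (Hrk : forall j, (0 <= r ^ j <= 1)%R).
  { intros j. split; [apply pow_le; lra|].
    rewrite <- (pow1 j). apply pow_incr. lra. }
  destruct (Nat.le_gt_cases N k) as [Hk|Hk].
  - replace (k ^ 2)%nat with (k * k)%nat by (simpl; lia).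
    rewrite pow_mult, <- Rpow_mult_distr.
    apply Rle_trans with ((1 / 2) ^ k)%R; [|nra].
    apply pow_incr. split.
    + apply Rmult_le_pos; [apply Hrk | lra].
    + apply Rle_trans with (2 := HN). apply Rmult_le_compat_r; [lra|].
      replace k with (N + (k - N))%nat by lia. rewrite pow_add.
      pose proof (Hrk N). pose proof (Hrk (k - N)%nat). nra.
  - assert (HAk : (1 <= A ^ k)%R) by (apply pow_R1_Rle; lra).
    apply Rle_trans with (A ^ k)%R.
    + pose proof (Hrk (k ^ 2)%nat). nra.
    + replace (A ^ k)%R with ((2 * A) ^ k * (1 / 2) ^ k)%R
        by (rewrite <- Rpow_mult_distr; f_equal; field).
      apply Rmult_le_compat_r; [lra|]. apply Rle_pow; [lra | lia].
Qed.

(** * The series [T x] and its telescoping relation *)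

(** The coefficient [c_k] of [T x]; [quad_term q x k] is the whole summand. *)
Definition quad_coeff (q : C) (k : nat) : C :=
  q ^ (k ^ 2 + 2 * k) * qint q (6 * k + 1)
  * (qpoch q (q ^ 2) k ^ 3 / qpoch (q ^ 4) (q ^ 4) k ^ 3).

Definition quad_term (q x : C) (k : nat) : C :=
  quad_coeff q k * shifted_pow x (q ^ 4) k
  * qpoch_inf (q ^ (2 * k + 3) * x) (q ^ 2).

(* The Wilf-Zeilberger certificate of the step [x -> q^4 x]. *)
Definition quad_cert (q x : C) (k : nat) : C :=
  - x * q ^ (k ^ 2 + 4 * k + 3)
  * (qpoch q (q ^ 2) (S k) ^ 3 / qpoch (q ^ 4) (q ^ 4) k ^ 3)
  * shifted_pow x (q ^ 4) k
  * qpoch_inf (q ^ (2 * k + 7) * x) (q ^ 2) / (1 - q).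

Lemma qint_eq (q : C) (n : nat) :
  (Cmod q < 1)%R -> qint q n = (1 - q ^ n) / (1 - q).
Proof.
  intros Hq. rewrite <- qint_mult. field. now apply one_minus_neq_0.
Qed.

Lemma qpoch_inf_shift_pow (q x : C) (m : nat) : (Cmod q < 1)%R ->
  qpoch_inf (q ^ m * x) (q ^ 2)
  = (1 - q ^ m * x) * qpoch_inf (q ^ (m + 2) * x) (q ^ 2).
Proof.
  intros Hq. rewrite qpoch_inf_shift by (apply Cmod_pow_lt_1; [exact Hq | lia]).
  rewrite Cpow_add_r. f_equal. f_equal. ring.
Qed.

(** The start of the telescoping: the certificate contributes nothing below index 0. *)
Lemma quad_term_dilate_0 (q x : C) : (Cmod q < 1)%R ->
  quad_term q x 0 - (1 - q ^ 4 * x) ^ 2 * quad_term q (q ^ 4 * x) 0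
  = quad_cert q x 0.
Proof.
  intros Hq. pose proof (one_minus_neq_0 q Hq) as H1.
  unfold quad_term, quad_coeff, quad_cert.
  rewrite (qpoch_inf_shift_pow q x (2 * 0 + 3)) by exact Hq.
  rewrite (qpoch_inf_shift_pow q x (2 * 0 + 3 + 2)) by exact Hq.
  simpl Nat.add. simpl Nat.mul.
  replace (q ^ 3 * (q ^ 4 * x)) with (q ^ 7 * x) by ring.
  simpl qpoch. simpl qint. simpl shifted_pow. simpl (0 ^ 2 + _)%nat.
  field. exact H1.
Qed.

(** All four terms share the tail [(q^(2k+9) x; q^2)_oo], the power [q ^ (k ^ 2)] and the finite
    products up to [k]. What remains is a rational identity in [q], [x] and [q ^ k], which [field]
    checks. *)
Lemma quad_term_dilate_S (q x : C) (k : nat) : (Cmod q < 1)%R ->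
  quad_term q x (S k) - (1 - q ^ 4 * x) ^ 2 * quad_term q (q ^ 4 * x) (S k)
  = quad_cert q x (S k) - quad_cert q x k.
Proof.
  intros Hq. pose proof (one_minus_neq_0 q Hq) as H1.
  assert (Hq4 := Cmod_pow_lt_1 q 4 Hq ltac:(lia)).
  pose proof (qpoch_neq_0 (q ^ 4) (q ^ 4) k Hq4 Hq4) as HD.
  pose proof (qpoch_neq_0 (q ^ 4) (q ^ 4) (S k) Hq4 Hq4) as HD'.
  unfold quad_term, quad_coeff, quad_cert.
  rewrite (qpoch_inf_shift_pow q x (2 * S k + 3)) by exact Hq.
  rewrite (qpoch_inf_shift_pow q x (2 * S k + 3 + 2)) by exact Hq.
  rewrite (qpoch_inf_shift_pow q x (2 * k + 7)) by exact Hq.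
  replace (q ^ (2 * S k + 3) * (q ^ 4 * x)) with (q ^ (2 * S k + 7) * x)
    by (replace (2 * S k + 7)%nat with (2 * S k + 3 + 4)%nat by lia;
        rewrite (Cpow_add_r q (2 * S k + 3)); ring).
  replace (2 * S k + 3 + 2 + 2)%nat with (2 * S k + 7)%nat by lia.
  replace (2 * k + 7 + 2)%nat with (2 * S k + 7)%nat by lia.
  set (E := qpoch_inf (q ^ (2 * S k + 7) * x) (q ^ 2)).
  rewrite shifted_pow_dilate, qint_eq by exact Hq.
  rewrite (qpoch_S q (q ^ 2) (S k)), (shifted_pow_S x).
  rewrite (qpoch_S (q ^ 4)) in HD' |- *.
  rewrite <- !(Cpow_mult_r q) in *.
  (* Exponents are brought to the shape [k ^ 2 + k * m + c], so that every power splits into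
     [q ^ (k ^ 2)], a power of [q ^ k] and a fixed power of [q]. *)
  replace (S k ^ 2 + 2 * S k)%nat with (k ^ 2 + k * 4 + 3)%nat by (simpl; lia).
  replace (S k ^ 2 + 4 * S k + 3)%nat with (k ^ 2 + k * 6 + 8)%nat by (simpl; lia).
  replace (k ^ 2 + 4 * k + 3)%nat with (k ^ 2 + k * 4 + 3)%nat by lia.
  replace (6 * S k + 1)%nat with (k * 6 + 7)%nat by lia.
  replace (2 * S k + 3)%nat with (k * 2 + 5)%nat by lia.
  replace (2 * k + 7)%nat with (k * 2 + 7)%nat by lia.
  replace (2 * S k)%nat with (k * 2 + 2)%nat by lia.
  replace (4 * k)%nat with (k * 4)%nat in * by lia.
  rewrite !(Cpow_add_r q), !(Cpow_mult_r q k) in *.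
  set (A := qpoch q (q ^ 2) (S k)) in *.
  set (D := qpoch (q ^ 4) (q ^ 4) k) in *.
  set (L := q ^ (k ^ 2)). set (K := q ^ k) in *.
  (* This is the last factor of [(q^4; q^4)_(k+1)], hence nonzero because the product is. *)
  assert (HK : 1 - q ^ 4 * K ^ 4 <> 0).
  { intros H0. apply HD'. rewrite H0. ring. }
  clearbody A D L K E. clear HD'.
  field. repeat split; [exact HD | exact H1 | rewrite Cpow_mult_l; exact HK].
Qed.

(** * Geometric bounds on the terms and the certificate *)

Lemma Cmod_pow_le_1 (q : C) (n : nat) : (Cmod q < 1)%R -> (Cmod q ^ n <= 1)%R.
Proof.
  intros Hq. rewrite <- (pow1 n). apply pow_incr.
  split; [apply Cmod_ge_0 | lra].
Qed.

(** The two lengths are independent because the terms use [k] and [k], the certificate [S k] and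
    [k]. *)
Lemma quad_ratio_bounded (q : C) : (Cmod q < 1)%R ->
  exists B : R, (0 <= B)%R /\ forall i j : nat,
    (Cmod (qpoch q (q ^ 2) i ^ 3 / qpoch (q ^ 4) (q ^ 4) j ^ 3) <= B)%R.
Proof.
  intros Hq.
  assert (Hq2 := Cmod_pow_lt_1 q 2 Hq ltac:(lia)).
  assert (Hq4 := Cmod_pow_lt_1 q 4 Hq ltac:(lia)).
  set (U := exp (Cmod q / (1 - Cmod (q ^ 2)))).
  set (V := exp (- (Cmod (q ^ 4) / (1 - Cmod (q ^ 4))
                    * / (1 - Cmod (q ^ 4))))).
  assert (HU : (0 < U)%R) by apply exp_pos.
  assert (HV : (0 < V)%R) by apply exp_pos.
  exists (U ^ 3 * / V ^ 3)%R. split.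
  { apply Rlt_le, Rmult_lt_0_compat; [now apply pow_lt|].
    now apply Rinv_0_lt_compat, pow_lt. }
  intros i j.
  rewrite Cmod_div, !Cmod_pow by (apply Cpow_nz; now apply qpoch_neq_0).
  apply Rmult_le_compat.
  - apply pow_le, Cmod_ge_0.
  - apply Rlt_le, Rinv_0_lt_compat, pow_lt, Cmod_gt_0. now apply qpoch_neq_0.
  - apply pow_incr. split; [apply Cmod_ge_0 | now apply qpoch_bounded].
  - apply Rinv_le_contravar; [now apply pow_lt|].
    apply pow_incr. split; [lra | now apply qpoch_ge].
Qed.

Lemma qpoch_inf_dilate_le (q x : C) (m : nat) (M : R) :
  (Cmod q < 1)%R -> (Cmod x <= M)%R ->
  (Cmod (qpoch_inf (q ^ m * x) (q ^ 2)) <= exp (M / (1 - Cmod (q ^ 2))))%R.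
Proof.
  intros Hq Hx. assert (Hq2 := Cmod_pow_lt_1 q 2 Hq ltac:(lia)).
  eapply Rle_trans; [now apply qpoch_inf_bounded|].
  apply exp_incr_le, Rmult_le_compat_r.
  - apply Rlt_le, Rinv_0_lt_compat; lra.
  - rewrite Cmod_mult, Cmod_pow.
    pose proof (Cmod_pow_le_1 q m Hq). pose proof (Cmod_ge_0 x). nra.
Qed.

(** Each factor of [shifted_pow] is at most [M + 1] in modulus, and [q ^ (k ^ 2)] beats any
    geometric growth. The spare exponent [m] absorbs [2 * k] in the terms and [4 * k + 3] in the
    certificate. *)
Lemma gaussian_shifted_le (q : C) (M : R) : (Cmod q < 1)%R -> (0 <= M)%R ->
  exists K : R, (0 <= K)%R /\ forall x k m, (Cmod x <= M)%R ->
    (Cmod (q ^ (k ^ 2 + m)) * Cmod (shifted_pow x (q ^ 4) k)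
     <= K * (1 / 2) ^ k)%R.
Proof.
  intros Hq HM.
  destruct (super_geometric_le (Cmod q) (M + 1)) as [K [HK0 HK]];
    [split; [apply Cmod_ge_0 | exact Hq] | lra |].
  exists K. split; [exact HK0|]. intros x k m Hx.
  apply Rle_trans with (2 := HK k).
  apply Rmult_le_compat; try apply Cmod_ge_0.
  - rewrite Cmod_pow, pow_add.
    pose proof (Cmod_pow_le_1 q m Hq).
    pose proof (pow_le (Cmod q) (k ^ 2) (Cmod_ge_0 q)). nra.
  - eapply Rle_trans.
    + apply shifted_pow_le, Rlt_le, Cmod_pow_lt_1; [exact Hq | lia].
    + apply pow_incr. pose proof (Cmod_ge_0 x). lra.
Qed.

(** Here [B] serves all [x] in the disc of radius [M] at once: this is the domination needed to let
    [x] tend to 0 under the sum. *)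
Lemma quad_term_le (q : C) (M : R) : (Cmod q < 1)%R -> (0 <= M)%R ->
  exists B : R, forall x k, (Cmod x <= M)%R ->
    (Cmod (quad_term q x k) <= B * (1 / 2) ^ k)%R.
Proof.
  intros Hq HM. pose proof (one_minus_neq_0 q Hq) as H1.
  destruct (quad_ratio_bounded q Hq) as [B [HB0 HB]].
  destruct (gaussian_shifted_le q M Hq HM) as [K [HK0 HK]].
  set (E := exp (M / (1 - Cmod (q ^ 2)))).
  (* Bounds [[6k+1] = (1 - q^(6k+1)) / (1 - q)] for every [k]. *)
  set (Q := (2 * / Cmod (1 - q))%R).
  exists (K * Q * B * E)%R. intros x k Hx.
  unfold quad_term, quad_coeff. rewrite !Cmod_mult.
  replace (K * Q * B * E * (1 / 2) ^ k)%R
    with (K * (1 / 2) ^ k * Q * B * E)%R by ring.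
  match goal with |- (?g * ?i * ?r * ?s * ?e <= _)%R =>
    replace (g * i * r * s * e)%R with (g * s * i * r * e)%R by ring end.
  assert (HQ : (Cmod (qint q (6 * k + 1)) <= Q)%R).
  { rewrite qint_eq, Cmod_div by assumption. unfold Q.
    apply Rmult_le_compat_r.
    - now apply Rlt_le, Rinv_0_lt_compat, Cmod_gt_0.
    - eapply Rle_trans; [apply Cmod_triangle|].
      rewrite Cmod_1, Cmod_opp, Cmod_pow.
      pose proof (Cmod_pow_le_1 q (6 * k + 1) Hq). lra. }
  pose proof (HK x k (2 * k)%nat Hx). pose proof (HB k k).
  pose proof (qpoch_inf_dilate_le q x (2 * k + 3) M Hq Hx).
  do 3 (apply Rmult_le_compat;
    [repeat apply Rmult_le_pos; apply Cmod_ge_0 | apply Cmod_ge_0 | | assumption]).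
  assumption.
Qed.

Lemma quad_cert_le (q x : C) : (Cmod q < 1)%R ->
  exists B : R, forall k, (Cmod (quad_cert q x k) <= B * (1 / 2) ^ k)%R.
Proof.
  intros Hq. pose proof (one_minus_neq_0 q Hq) as H1.
  destruct (quad_ratio_bounded q Hq) as [B [HB0 HB]].
  destruct (gaussian_shifted_le q (Cmod x) Hq (Cmod_ge_0 x)) as [K [HK0 HK]].
  set (E := exp (Cmod x / (1 - Cmod (q ^ 2)))).
  exists (K * Cmod x * B * E * / Cmod (1 - q))%R. intros k.
  unfold quad_cert. rewrite Cmod_div, !Cmod_mult, Cmod_opp by exact H1.
  rewrite <- Nat.add_assoc.
  replace (K * Cmod x * B * E * / Cmod (1 - q) * (1 / 2) ^ k)%R
    with (K * (1 / 2) ^ k * Cmod x * B * E * / Cmod (1 - q))%R by ring.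
  match goal with |- (?i * ?g * ?r * ?s * ?e / ?d <= _)%R =>
    replace (i * g * r * s * e / d)%R with (g * s * i * r * e * / d)%R
      by (unfold Rdiv; ring) end.
  apply Rmult_le_compat_r; [now apply Rlt_le, Rinv_0_lt_compat, Cmod_gt_0|].
  pose proof (HK x k (4 * k + 3)%nat (Rle_refl _)). pose proof (HB (S k) k).
  pose proof (qpoch_inf_dilate_le q x (2 * k + 7) (Cmod x) Hq (Rle_refl _)).
  do 3 (apply Rmult_le_compat;
    [repeat apply Rmult_le_pos; apply Cmod_ge_0 | apply Cmod_ge_0 | | assumption || apply Rle_refl]).
  assumption.
Qed.

(** * The functional equation of [T] and its iteration *)

Lemma is_lim_seq_half_pow (B : R) : is_lim_seq (fun k => B * (1 / 2) ^ k)%R 0.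
Proof.
  replace (Finite 0) with (Rbar_mult B 0) by (simpl; f_equal; ring).
  apply is_lim_seq_scal_l, is_lim_seq_geom. rewrite Rabs_pos_eq; lra.
Qed.

Lemma ex_series_half_pow (B : R) : ex_series (fun k => B * (1 / 2) ^ k)%R.
Proof.
  apply (ex_series_scal (V := R_NormedModule)), ex_series_geom.
  rewrite Rabs_pos_eq; lra.
Qed.

Lemma ex_series_quad_term (q x : C) : (Cmod q < 1)%R ->
  exists l : C, is_series (V := C_NormedModule) (quad_term q x) l.
Proof.
  intros Hq. destruct (quad_term_le q (Cmod x) Hq (Cmod_ge_0 x)) as [B HB].
  apply (ex_series_le (V := C_CompleteNormedModule) (quad_term q x))
    with (b := fun k => (B * (1 / 2) ^ k)%R).
  - intros k. apply HB, Rle_refl.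
  - apply ex_series_half_pow.
Qed.

(** Summing the telescoping relation up to [n] leaves only the boundary term [quad_cert q x n],
    which tends to 0. *)
Lemma is_series_quad_term_dilate (q x l : C) : (Cmod q < 1)%R ->
  is_series (V := C_NormedModule) (quad_term q (q ^ 4 * x)) l ->
  is_series (V := C_NormedModule) (quad_term q x) ((1 - q ^ 4 * x) ^ 2 * l).
Proof.
  intros Hq Hl.
  set (c := (1 - q ^ 4 * x) ^ 2).
  assert (Hs : forall n,
    c * sum_n (G := C_AbelianMonoid) (quad_term q (q ^ 4 * x)) n + quad_cert q x n
    = sum_n (G := C_AbelianMonoid) (quad_term q x) n).
  { induction n as [|n IH].
    - rewrite !(sum_O (G := C_AbelianMonoid)).
      rewrite <- quad_term_dilate_0 by exact Hq. fold c. ring.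
    - rewrite !sum_n_S, <- IH.
      pose proof (quad_term_dilate_S q x n Hq) as H. fold c in H.
      replace (quad_cert q x (S n))
        with (quad_term q x (S n) - c * quad_term q (q ^ 4 * x) (S n)
              + quad_cert q x n) by (rewrite H; ring).
      ring. }
  apply is_Clim_ext with (1 := Hs).
  replace (c * l) with (c * l + 0) by ring.
  apply is_Clim_plus.
  - apply is_Clim_mult; [apply is_Clim_const | exact Hl].
  - destruct (quad_cert_le q x Hq) as [B HB].
    apply is_Clim_of_le with (fun k => (B * (1 / 2) ^ k)%R).
    + intros n. replace (quad_cert q x n - 0) with (quad_cert q x n) by ring.
      apply HB.
    + apply is_lim_seq_half_pow.
Qed.

Lemma is_series_quad_term_iter (q x l : C) (n : nat) : (Cmod q < 1)%R ->
  is_series (V := C_NormedModule) (quad_term q ((q ^ 4) ^ n * x)) l ->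
  is_series (V := C_NormedModule) (quad_term q x)
    (qpoch (q ^ 4 * x) (q ^ 4) n ^ 2 * l).
Proof.
  intros Hq. revert l. induction n as [|n IH]; intros l Hl.
  - replace (qpoch (q ^ 4 * x) (q ^ 4) 0 ^ 2 * l) with l by (simpl; ring).
    replace x with ((q ^ 4) ^ 0 * x) by (simpl; ring). exact Hl.
  - rewrite qpoch_S.
    replace ((qpoch (q ^ 4 * x) (q ^ 4) n
              * (1 - q ^ 4 * x * (q ^ 4) ^ n)) ^ 2 * l)
      with (qpoch (q ^ 4 * x) (q ^ 4) n ^ 2
            * ((1 - q ^ 4 * ((q ^ 4) ^ n * x)) ^ 2 * l)) by ring.
    apply IH, is_series_quad_term_dilate; [exact Hq|].
    rewrite Cmult_assoc, <- Cpow_S. exact Hl.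
Qed.

(** The bound of [qpoch_inf_minus_1_le] is continuous in [Cmod a] and vanishes at 0. *)
Lemma is_Clim_qpoch_inf_0 (q : C) (y : nat -> C) : (Cmod q < 1)%R ->
  is_Clim y 0 -> is_Clim (fun n => qpoch_inf (y n) q) 1.
Proof.
  intros Hq Hy.
  apply is_Clim_of_le
    with (fun n => exp (Cmod (y n) / (1 - Cmod q)) * Cmod (y n)
                   * / (1 - Cmod q))%R.
  { intros n. now apply qpoch_inf_minus_1_le. }
  assert (Hm : is_lim_seq (fun n => Cmod (y n)) 0).
  { apply is_lim_seq_spec. intros eps.
    destruct (proj1 (is_Clim_spec y 0) Hy eps) as [N HN].
    exists N. intros n Hn. specialize (HN n Hn).
    replace (y n - 0) with (y n) in HN by ring.
    rewrite Rminus_0_r, Rabs_pos_eq; [exact HN | apply Cmod_ge_0]. }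
  (* The limit 0 is written as the bound evaluated at modulus 0, so that the limit rules apply
     factor by factor. *)
  replace 0%R with (exp (0 * / (1 - Cmod q)) * 0 * / (1 - Cmod q))%R by ring.
  apply is_lim_seq_mult'; [|apply is_lim_seq_const].
  apply is_lim_seq_mult'; [|exact Hm].
  apply (is_lim_seq_continuous exp (fun n => Cmod (y n) / (1 - Cmod q)))%R.
  - apply derivable_continuous_pt, derivable_pt_exp.
  - apply is_lim_seq_mult'; [exact Hm | apply is_lim_seq_const].
Qed.

Lemma qpoch_inf_0 (q : C) : qpoch_inf 0 q = 1.
Proof.
  apply is_qpoch_inf_unique, (is_Clim_ext (fun _ => 1));
    [|apply is_Clim_const].
  induction n as [|n IH]; [reflexivity|].
  rewrite qpoch_S, <- IH. ring.
Qed.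

Lemma is_Clim_quad_term_0 (q : C) (y : nat -> C) (k : nat) : (Cmod q < 1)%R ->
  is_Clim y 0 -> is_Clim (fun n => quad_term q (y n) k) (quad_term q 0 k).
Proof.
  intros Hq Hy. unfold quad_term.
  replace (q ^ (2 * k + 3) * 0) with (RtoC 0) by ring.
  rewrite qpoch_inf_0.
  apply is_Clim_mult.
  - apply is_Clim_mult; [apply is_Clim_const | now apply is_Clim_shifted_pow].
  - apply is_Clim_qpoch_inf_0.
    + apply Cmod_pow_lt_1; [exact Hq | lia].
    + replace (RtoC 0) with (q ^ (2 * k + 3) * 0) by ring.
      apply is_Clim_mult; [apply is_Clim_const | exact Hy].
Qed.

Lemma is_Clim_pow_0 (p : C) : (Cmod p < 1)%R -> is_Clim (fun n => p ^ n) 0.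
Proof.
  intros Hp. apply is_Clim_of_le with (fun n => (Cmod p ^ n)%R).
  - intros n. replace (p ^ n - 0) with (p ^ n) by ring.
    rewrite Cmod_pow. lra.
  - apply is_lim_seq_geom. rewrite Rabs_pos_eq; [exact Hp | apply Cmod_ge_0].
Qed.

(** The functional equation applied [n] times gives [T x = (q^4 x; q^4)_n^2 * T (q^(4n) x)] for
    every [n]. The left side is constant; on the right the product converges, and [T (q^(4n) x)]
    tends to [T 0] by [tannery]. *)
Lemma is_series_quad_term (q x l : C) : (Cmod q < 1)%R ->
  is_series (V := C_NormedModule) (quad_term q 0) l ->
  is_series (V := C_NormedModule) (quad_term q x)
    (qpoch_inf (q ^ 4 * x) (q ^ 4) ^ 2 * l).
Proof.
  intros Hq Hl. assert (Hq4 := Cmod_pow_lt_1 q 4 Hq ltac:(lia)).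
  destruct (ex_series_quad_term q x Hq) as [s Hs].
  set (y := fun n => (q ^ 4) ^ n * x).
  set (t := fun n => iota (T := C_CompleteNormedModule)
              (is_series (V := C_NormedModule) (quad_term q (y n)))).
  assert (Ht : forall n, is_series (V := C_NormedModule) (quad_term q (y n)) (t n)).
  { intros n. destruct (ex_series_quad_term q (y n) Hq) as [r Hr].
    replace (t n) with r; [exact Hr|]. symmetry.
    exact (iota_filterlim_locally (V := C_CompleteNormedModule)
             (F := eventually) _ r Hr). }
  assert (Hy : is_Clim y 0).
  { replace (RtoC 0) with (0 * x) by ring.
    apply is_Clim_mult; [now apply is_Clim_pow_0 | apply is_Clim_const]. }
  assert (Htl : is_Clim t l).
  { destruct (quad_term_le q (Cmod x) Hq (Cmod_ge_0 x)) as [B HB].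
    apply tannery with (u := fun n => quad_term q (y n)) (v := quad_term q 0)
      (b := fun k => (B * (1 / 2) ^ k)%R); [| | |exact Ht|exact Hl].
    - apply ex_series_half_pow.
    - intros n k. apply HB. unfold y.
      rewrite Cmod_mult, Cmod_pow. pose proof (Cmod_ge_0 x).
      pose proof (Cmod_pow_le_1 (q ^ 4) n Hq4). nra.
    - intros k. now apply is_Clim_quad_term_0. }
  replace (qpoch_inf (q ^ 4 * x) (q ^ 4) ^ 2 * l) with s; [exact Hs|].
  apply is_Clim_unique with (fun n => qpoch (q ^ 4 * x) (q ^ 4) n ^ 2 * t n).
  - apply is_Clim_ext with (fun _ => s); [|apply is_Clim_const].
    intros n. apply is_Cseries_unique with (quad_term q x); [exact Hs|].
    apply is_series_quad_term_iter; [exact Hq | apply Ht].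
  - apply is_Clim_mult; [|exact Htl].
    apply is_Clim_pow. now apply qpoch_inf_correct.
Qed.

(** * Evaluation at [x = 1], [x = 0] and [x = q^(-2)] *)

Lemma is_Cseries_single (a : nat -> C) :
  (forall k, a (S k) = 0) -> is_series (V := C_NormedModule) a (a O).
Proof.
  intros Ha. apply is_Clim_ext with (fun _ => a O); [|apply is_Clim_const].
  induction n as [|n IH].
  - symmetry. apply (sum_O (G := C_AbelianMonoid)).
  - rewrite sum_n_S, Ha, Cplus_0_r. exact IH.
Qed.

(** [T 1] is computed twice: from the product formula, as [(q^4; q^4)_oo^2 * T 0], and directly, as
    its term at [k = 0], the factor [x - 1] killing all others. The infinite product is nonzero and
    can be divided out. *)
Lemma is_series_quad_term_0 (q : C) : (Cmod q < 1)%R ->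
  is_series (V := C_NormedModule) (quad_term q 0)
    (qpoch_inf (q ^ 3) (q ^ 2) / qpoch_inf (q ^ 4) (q ^ 4) ^ 2).
Proof.
  intros Hq. assert (Hq4 := Cmod_pow_lt_1 q 4 Hq ltac:(lia)).
  pose proof (qpoch_inf_neq_0 (q ^ 4) (q ^ 4) Hq4 Hq4) as HD.
  destruct (ex_series_quad_term q 0 Hq) as [l Hl].
  pose proof (is_series_quad_term q 1 l Hq Hl) as H1.
  assert (H1' : is_series (V := C_NormedModule) (quad_term q 1)
                  (quad_term q 1 0)).
  { apply is_Cseries_single. intros k. unfold quad_term.
    rewrite shifted_pow_1. ring. }
  pose proof (is_Cseries_unique _ _ _ H1 H1') as E.
  rewrite Cmult_1_r in E.
  replace (quad_term q 1 0) with (qpoch_inf (q ^ 3) (q ^ 2)) in E.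
  - rewrite <- E.
    replace (qpoch_inf (q ^ 4) (q ^ 4) ^ 2 * l / qpoch_inf (q ^ 4) (q ^ 4) ^ 2)
      with l by (field; exact HD).
    exact Hl.
  - unfold quad_term, quad_coeff. simpl (2 * 0 + 3)%nat.
    replace (q ^ 3 * 1) with (q ^ 3) by ring.
    simpl qpoch. simpl qint. simpl shifted_pow. simpl (0 ^ 2 + _)%nat.
    field.
Qed.

Lemma quad_term_0_eq (q : C) (k : nat) :
  quad_term q 0 k
  = (- (1)) ^ k * q ^ (3 * k ^ 2) * qint q (6 * k + 1)
    * (qpoch q (q ^ 2) k ^ 3 / qpoch (q ^ 4) (q ^ 4) k ^ 3).
Proof.
  unfold quad_term, quad_coeff.
  replace (q ^ (2 * k + 3) * 0) with (RtoC 0) by ring.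
  rewrite qpoch_inf_0.
  replace (shifted_pow 0 (q ^ 4) k) with (shifted_pow 0 ((q ^ 2) ^ 2) k)
    by (f_equal; ring).
  rewrite shifted_pow_0, <- Cpow_mult_r.
  (* The truncated [k - 1] is harmless: at [k = 0] it is multiplied by [k]. *)
  replace (3 * k ^ 2)%nat with (k ^ 2 + 2 * k + 2 * (k * (k - 1)))%nat
    by (destruct k; simpl; nia).
  rewrite (Cpow_add_r q (k ^ 2 + 2 * k)). unfold Cdiv. ring.
Qed.

(** At [x = q^(-2)] the infinite product is [(q^(2k+1); q^2)_oo], which one of the three factors
    [(q; q^2)_k] completes to [(q; q^2)_oo]. The part [q^(2k)] of [c_k] turns [shifted_pow] into
    [(q^2; q^4)_k]. *)
Lemma quad_term_inv_sqr_eq (q : C) (k : nat) : (Cmod q < 1)%R -> q <> 0 ->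
  quad_term q (/ q ^ 2) k
  = qpoch_inf q (q ^ 2)
    * (q ^ (k ^ 2) * qint q (6 * k + 1)
       * (qpoch q (q ^ 2) k ^ 2 * qpoch (q ^ 2) (q ^ 4) k
          / qpoch (q ^ 4) (q ^ 4) k ^ 3)).
Proof.
  intros Hq Hq0. assert (Hq2 := Cmod_pow_lt_1 q 2 Hq ltac:(lia)).
  assert (Hq4 := Cmod_pow_lt_1 q 4 Hq ltac:(lia)).
  unfold quad_term, quad_coeff.
  rewrite (qpoch_inf_split q (q ^ 2) k) by exact Hq2.
  replace (q ^ (2 * k + 3) * / q ^ 2) with (q * (q ^ 2) ^ k).
  2:{ rewrite Cpow_add_r, Cpow_mult_r. field. exact Hq0. }
  rewrite <- (shifted_pow_inv (q ^ 2)) by now apply Cpow_nz.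
  rewrite Cpow_add_r, (Cpow_mult_r q 2 k). unfold Cdiv. ring.
Qed.

Lemma qpoch_inf_q3 (q : C) : (Cmod q < 1)%R ->
  qpoch_inf (q ^ 3) (q ^ 2)
  = qpoch_inf (q ^ 3) (q ^ 4) * qpoch_inf (q ^ 5) (q ^ 4).
Proof.
  intros Hq. rewrite qpoch_inf_even_odd
    by (apply Cmod_pow_lt_1; [exact Hq | lia]).
  f_equal; f_equal; ring.
Qed.

(** The point [x = q^(-2)] does not exist for [q = 0]. There [0 ^ (k ^ 2)] leaves only the term
    [k = 0], equal to 1, and all the infinite products are 1. *)
Lemma is_series_quadratic_zero_base :
  is_series (V := C_NormedModule)
    (fun k : nat =>
       0 ^ (k ^ 2) * qint 0 (6 * k + 1)
       * (qpoch 0 (0 ^ 2) k ^ 2 * qpoch (0 ^ 2) (0 ^ 4) k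
          / qpoch (0 ^ 4) (0 ^ 4) k ^ 3))
    ((1 + 0) * qpoch_inf (0 ^ 2) (0 ^ 4) * qpoch_inf (0 ^ 6) (0 ^ 4)
     / qpoch_inf (0 ^ 4) (0 ^ 4) ^ 2).
Proof.
  replace ((1 + 0) * qpoch_inf (0 ^ 2) (0 ^ 4) * qpoch_inf (0 ^ 6) (0 ^ 4)
           / qpoch_inf (0 ^ 4) (0 ^ 4) ^ 2) with (RtoC 1).
  - match goal with |- is_series ?a _ => replace (RtoC 1) with (a O) end.
    + apply is_Cseries_single. intros k.
      (* Exhibits the exponent as a successor, so that a factor 0 splits off. *)
      change (S k ^ 2)%nat with (S (k * 1 + k * S (k * 1)))%nat.
      rewrite Cpow_S. unfold Cdiv. ring.
    + simpl qpoch. simpl qint. simpl (0 ^ 2)%nat. field.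
  - replace (0 ^ 2) with (RtoC 0) by ring.
    replace (0 ^ 6) with (RtoC 0) by ring.
    replace (0 ^ 4) with (RtoC 0) by ring.
    rewrite qpoch_inf_0. field.
Qed.

Lemma is_series_quadratic (q : C) : (Cmod q < 1)%R -> q <> 0 ->
  is_series (V := C_NormedModule)
    (fun k : nat =>
       q ^ (k ^ 2) * qint q (6 * k + 1)
       * (qpoch q (q ^ 2) k ^ 2 * qpoch (q ^ 2) (q ^ 4) k
          / qpoch (q ^ 4) (q ^ 4) k ^ 3))
    ((1 + q) * qpoch_inf (q ^ 2) (q ^ 4) * qpoch_inf (q ^ 6) (q ^ 4)
     / qpoch_inf (q ^ 4) (q ^ 4) ^ 2).
Proof.
  intros Hq Hq0.
  assert (Hq2 := Cmod_pow_lt_1 q 2 Hq ltac:(lia)).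
  assert (Hq3 := Cmod_pow_lt_1 q 3 Hq ltac:(lia)).
  assert (Hq4 := Cmod_pow_lt_1 q 4 Hq ltac:(lia)).
  pose proof (qpoch_inf_neq_0 (q ^ 4) (q ^ 4) Hq4 Hq4) as HD.
  pose proof (qpoch_inf_neq_0 (q ^ 3) (q ^ 2) Hq3 Hq2) as HO.
  pose proof (qpoch_inf_neq_0 q (q ^ 2) Hq Hq2) as HO'.
  pose proof (is_series_quad_term q (/ q ^ 2) _ Hq (is_series_quad_term_0 q Hq))
    as H.
  apply (is_series_scal (V := C_NormedModule) (/ qpoch_inf q (q ^ 2))) in H.
  replace (q ^ 4 * / q ^ 2) with (q ^ 2) in H by (field; exact Hq0).
  set (A := qpoch_inf (q ^ 2) (q ^ 4)) in *.
  match type of H with is_series _ ?l =>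
    replace ((1 + q) * A * qpoch_inf (q ^ 6) (q ^ 4)
             / qpoch_inf (q ^ 4) (q ^ 4) ^ 2) with (l : C) end.
  - apply is_series_ext with (2 := H). intros k.
    change (/ qpoch_inf q (q ^ 2) * quad_term q (/ q ^ 2) k = 
      q ^ (k ^ 2) * qint q (6 * k + 1)
       * (qpoch q (q ^ 2) k ^ 2 * qpoch (q ^ 2) (q ^ 4) k
          / qpoch (q ^ 4) (q ^ 4) k ^ 3)).
    rewrite quad_term_inv_sqr_eq, Cmult_assoc, Cinv_l by assumption.
    apply Cmult_1_l.
  - change (/ qpoch_inf q (q ^ 2)
            * (A ^ 2 * (qpoch_inf (q ^ 3) (q ^ 2)
                        / qpoch_inf (q ^ 4) (q ^ 4) ^ 2))
            = (1 + q) * A * qpoch_inf (q ^ 6) (q ^ 4)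
              / qpoch_inf (q ^ 4) (q ^ 4) ^ 2).
    (* One of the two factors [A] and the product [(q; q^2)_oo] each release their first factor; the
       quotient [(1 - q^2) / (1 - q)] is the [1 + q] of the result. *)
    assert (HA : A = (1 - q ^ 2) * qpoch_inf (q ^ 6) (q ^ 4)).
    { unfold A. rewrite qpoch_inf_shift by exact Hq4.
      replace (q ^ 2 * q ^ 4) with (q ^ 6) by ring. reflexivity. }
    rewrite (qpoch_inf_shift q) by exact Hq2.
    replace (q * q ^ 2) with (q ^ 3) by ring.
    rewrite HA. field.
    repeat split; [exact HD | exact HO | now apply one_minus_neq_0].
Qed.

Theorem theorem1p1 (q : C) (hq : (Cmod q < 1)%R) :
  is_series (V := C_NormedModule)
    (fun k : nat =>
       q ^ (k ^ 2) * qint q (6 * k + 1)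
       * (qpoch q (q ^ 2) k ^ 2 * qpoch (q ^ 2) (q ^ 4) k
          / qpoch (q ^ 4) (q ^ 4) k ^ 3))
    ((1 + q) * qpoch_inf (q ^ 2) (q ^ 4) * qpoch_inf (q ^ 6) (q ^ 4)
     / qpoch_inf (q ^ 4) (q ^ 4) ^ 2)
  /\
  is_series (V := C_NormedModule)
    (fun k : nat =>
       (- (1)) ^ k * q ^ (3 * k ^ 2) * qint q (6 * k + 1)
       * (qpoch q (q ^ 2) k ^ 3 / qpoch (q ^ 4) (q ^ 4) k ^ 3))
    (qpoch_inf (q ^ 3) (q ^ 4) * qpoch_inf (q ^ 5) (q ^ 4)
     / qpoch_inf (q ^ 4) (q ^ 4) ^ 2).
Proof.
  split.
  - destruct (Ceq_dec q 0) as [->|Hq0].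
    + exact is_series_quadratic_zero_base.
    + now apply is_series_quadratic.
  - rewrite <- qpoch_inf_q3 by exact hq.
    apply is_series_ext with (2 := is_series_quad_term_0 q hq).
    intros k. apply quad_term_0_eq.
Qed.
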